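(* Let $n>2$ and let $F:=e_2e_1^\top\in\mathbb{R}^{n\times n}$, so that $Fp=p^1e_2$ for $p\in\mathcal{S}$. Then for all $p\in\mathcal{S}$ the first coordinate satisfies $$\big(R_p(F-F^\top)R_pFp\big)^1=-(p^1)^2p^2(1-p^1-p^2)\neq 0 .$$ Consequently, for every $m\ge1$, the linear affinity map $\mathcal{F}\colon\mathcal{W}\to\mathbb{R}^{m\times n}$ defined row-wise by $(\mathcal{F}[W])_i:=FW_i$, $i=1,\dots,m$, violates the condition $\mathcal{R}_W\circ(d\mathcal{F}|_W-d\mathcal{F}|_W^* )\circ\mathcal{R}_W[\mathcal{F}[W]]=0$ at every $W\in\mathcal{W}$, and solutions $W\colon[t_0,t_1]\to\mathcal{W}$ (with $t_0<t_1$) of the assignment flow $\dot W=\mathcal{R}_W[\mathcal{F}[W]]$ are not critical points of the action functional $$\mathcal{L}(W) = \int_{t_0}^{t_1} \tfrac{1}{2}\|\dot{W}(t)\|_g^2 + \tfrac{1}{2}\sum_{i=1}^m \mathrm{Var}_{W_i(t)}\big((\mathcal{F}[W(t)])_i\big)\, dt .$$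
   Context: $e_1,\dots,e_n$ is the standard basis of $\mathbb{R}^n$; upper indices denote coordinates of vectors (so $(p^1)^2$ is the square of the first coordinate, and $p^2$ is the second coordinate). $\mathcal{S}=\{p\in\mathbb{R}^n: p>0,\ \sum_jp^j=1\}$, and $R_p=\mathrm{Diag}(p)-pp^\top$. Write $A_i$ for the $i$-th row of a matrix $A$, regarded as a column vector. The assignment manifold is $\mathcal{W} = \{W\in\mathbb{R}^{m\times n} : W>0 \text{ entrywise},\ W\mathbf{1}_n=\mathbf{1}_m\}$. All its tangent spaces are identified with $\mathcal{T}_0=\{V\in\mathbb{R}^{m\times n}: V\mathbf{1}_n=0\}$. It carries the Fisher-Rao metric $g_W(U,V)=\sum_{i,j} U_{ij}V_{ij}/W_{ij}$, and $\|V\|_g^2=g_W(V,V)$. The replicator operator $\mathcal{R}_W\colon\mathbb{R}^{m\times n}\to\mathcal{T}_0$ is defined row-wise by $(\mathcal{R}_W[X])_i = R_{W_i}X_i$. For a probability vector $p$, $\mathrm{Var}_p(a)=\sum_j p^j (a^j)^2-\big(\sum_j p^ja^j\big)^2$. The differential $d\mathcal{F}|_W$ is viewed as a linear map $\mathcal{T}_0\to\mathbb{R}^{m\times n}$, and $d\mathcal{F}|_W^*\colon\mathbb{R}^{m\times n}\to\mathcal{T}_0$ is its adjoint with respect to the matrix inner product $\langle A,B\rangle=\mathrm{tr}(A^\top B)$. A critical point of $\mathcal{L}$ is a curve at which the first variation of $\mathcal{L}$ vanishes for all smooth variations through curves in $\mathcal{W}$ with fixed endpoints. *)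

(* Defs.v *)
From HB Require Import structures.
From mathcomp Require Import all_boot all_order all_algebra.
From mathcomp Require Import all_classical all_reals all_analysis.

Set Implicit Arguments.
Unset Strict Implicit.
Unset Printing Implicit Defensive.

Import Order.TTheory GRing.Theory Num.Theory.
Import numFieldNormedType.Exports.

Local Open Scope classical_set_scope.
Local Open Scope ring_scope.

Section Algebra.
Context {R : realType}.

Definition std_basis n (i : 'I_n) : 'cV[R]_n := delta_mx i 0.

Definition simplex n : set 'cV[R]_n :=
  [set p : 'cV[R]_n | (forall j, 0 < p j 0) /\ \sum_j p j 0 = 1].

(* R_p = Diag(p) - p p^T *)
Definition replicator_mx n (p : 'cV[R]_n) : 'M[R]_n := diag_mx p^T - p *m p^T.

(* the i-th row of A, regarded as a column vector *)
Definition rowc m n (A : 'M[R]_(m, n)) (i : 'I_m) : 'cV[R]_n := (row i A)^T.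

Definition assignment_manifold m n : set 'M[R]_(m, n) :=
  [set W : 'M[R]_(m, n) | (forall i j, 0 < W i j) /\
           W *m (const_mx 1 : 'cV[R]_n) = (const_mx 1 : 'cV[R]_m)].

Definition tangent m n : set 'M[R]_(m, n) :=
  [set V : 'M[R]_(m, n) | V *m (const_mx 1 : 'cV[R]_n) = 0].

Definition fisher m n (W U V : 'M[R]_(m, n)) : R :=
  \sum_i \sum_j U i j * V i j / W i j.

Definition replicator m n (W X : 'M[R]_(m, n)) : 'M[R]_(m, n) :=
  \matrix_(i, j) (replicator_mx (rowc W i) *m rowc X i) j 0.

Definition Var n (p a : 'cV[R]_n) : R :=
  \sum_j p j 0 * a j 0 ^+ 2 - (\sum_j p j 0 * a j 0) ^+ 2.

Definition rowwise m n (F : 'M[R]_n) (W : 'M[R]_(m, n)) : 'M[R]_(m, n) :=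
  \matrix_(i, j) (F *m rowc W i) j 0.

Definition mxdot m n (A B : 'M[R]_(m, n)) : R := \tr (A^T *m B).

(* Only the values of A on the tangent space matter; B takes its values in the
   tangent space. *)
Definition is_adjoint m n (A B : 'M[R]_(m, n) -> 'M[R]_(m, n)) : Prop :=
  (forall X, tangent (B X)) /\
  (forall V X, tangent V -> mxdot (A V) X = mxdot V (B X)).

(* By is_adjointP and is_adjoint_unique below, this is the adjoint whenever A
   is linear. *)
Definition adjoint m n (A : 'M[R]_(m, n) -> 'M[R]_(m, n)) :
    'M[R]_(m, n) -> 'M[R]_(m, n) :=
  get (is_adjoint A).

Lemma mxdotE m n (A B : 'M[R]_(m, n)) :
  mxdot A B = \sum_i \sum_j A i j * B i j.
Proof.
rewrite /mxdot /mxtrace [RHS]exchange_big /=; apply: eq_bigr => j _.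
by rewrite !mxE; apply: eq_bigr => i _; rewrite !mxE.
Qed.

Lemma tangentP m n (V : 'M[R]_(m, n)) :
  tangent V <-> forall i, \sum_j V i j = 0.
Proof.
rewrite /tangent /=; split => [/matrixP VE i|V0].
  have := VE i 0; rewrite !mxE => VEi; rewrite -[RHS]VEi.
  by apply: eq_bigr => j _; rewrite mxE mulr1.
apply/matrixP => i k; rewrite !mxE -[RHS](V0 i).
by apply: eq_bigr => j _; rewrite mxE mulr1.
Qed.

Lemma is_adjointP m n (A : {linear 'M[R]_(m, n) -> 'M[R]_(m, n)}) :
  is_adjoint A (adjoint A).
Proof.
rewrite /adjoint; apply: getPex.
pose P (V : 'M[R]_(m, n)) : 'M[R]_(m, n) :=
  \matrix_(i, j) (V i j - n%:R^-1 * \sum_k V i k).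
pose E i j : 'M[R]_(m, n) := delta_mx i j.
have sumPE i : \sum_j P (E i j) = 0.
  apply/matrixP => k l; rewrite summxE.
  have n0 : n%:R != 0 :> R by rewrite pnatr_eq0; case: (n) l => // -[].
  under eq_bigr => j _.
    rewrite !mxE (_ : \sum_k0 _ = (k == i)%:R); last first.
      rewrite (bigD1 j)//= mxE eqxx andbT big1 ?addr0// => q qj.
      by rewrite mxE (negbTE qj) andbF.
    over.
  rewrite sumrB sumr_const card_ord -[(_ * _) *+ n]mulr_natl mulrA mulfV// mul1r mxE.
  rewrite (bigD1 l)//= eqxx andbT big1 ?addr0 ?subrr// => q ql.
  by rewrite [l == q]eq_sym (negbTE ql) andbF.
have PV V : tangent V -> V = \sum_i \sum_j V i j *: P (E i j).
  move=> /tangentP V0.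
  apply/matrixP => k l; rewrite summxE (bigD1 k)//= [X in _ + X]big1 ?addr0.
    rewrite summxE.
    under eq_bigr => j _.
      rewrite !mxE eqxx (_ : \sum_k0 _ = 1); last first.
        rewrite (bigD1 j)//= mxE !eqxx big1 ?addr0// => q qj.
        by rewrite mxE (negbTE qj) andbF.
      rewrite mulrBr.
      over.
    rewrite sumrB -mulr_suml V0 mul0r subr0.
    rewrite (bigD1 l)//= eqxx mulr1 big1 ?addr0// => q ql.
    by rewrite eq_sym (negbTE ql) mulr0.
  move=> i ik; rewrite summxE big1// => j _; rewrite !mxE eq_sym (negbTE ik) /=.
  rewrite big1 ?mulr0 ?subrr ?mulr0// => q _.
  by rewrite mxE eq_sym (negbTE ik).
have dotDl (U V X : 'M[R]_(m, n)) : mxdot (U + V) X = mxdot U X + mxdot V X.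
  by rewrite /mxdot linearD mulmxDl linearD.
have dotZl a (U X : 'M[R]_(m, n)) : mxdot (a *: U) X = a * mxdot U X.
  by rewrite /mxdot linearZ -scalemxAl linearZ.
have dot0 (X : 'M[R]_(m, n)) : mxdot 0 X = 0.
  by rewrite /mxdot trmx0 mul0mx linear0.
have dot_sum I (r : seq I) (G : I -> 'M[R]_(m, n)) X :
    mxdot (\sum_(i <- r) G i) X = \sum_(i <- r) mxdot (G i) X.
  exact: (big_morph (fun U => mxdot U X) (fun U V => dotDl U V X) (dot0 X)).
exists (fun X => \matrix_(i, j) mxdot (A (P (E i j))) X); split => [X|V X V0].
  apply/tangentP => i; under eq_bigr do rewrite mxE.
  by rewrite -dot_sum -linear_sum sumPE linear0 dot0.
rewrite {1}(PV _ V0) linear_sum dot_sum mxdotE; apply: eq_bigr => i _.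
rewrite linear_sum dot_sum; apply: eq_bigr => j _.
by rewrite linearZ dotZl mxE.
Qed.

Lemma is_adjoint_unique m n (A B B' : 'M[R]_(m, n) -> 'M[R]_(m, n)) :
  is_adjoint A B -> is_adjoint A B' -> B = B'.
Proof.
move=> [B0 BA] [B'0 B'A]; apply/funext => X.
pose V := B X - B' X.
have V0 : tangent V.
  by rewrite /tangent /V /= mulmxBl (B0 X) (B'0 X) subrr.
have : mxdot V V = 0.
  rewrite {2}/V /mxdot mulmxBr linearB /= -/(mxdot V (B X)) -/(mxdot V (B' X)).
  by rewrite -BA// -B'A// subrr.
rewrite mxdotE => /eqP.
have sq i j : 0 <= V i j * V i j by rewrite -expr2 sqr_ge0.
rewrite psumr_eq0 => [/allP VE|i _]; last by apply: sumr_ge0.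
apply/eqP; rewrite -subr_eq0; apply/eqP/matrixP => i j.
have := VE i (mem_index_enum _); rewrite psumr_eq0//= => /allP VEi.
have := VEi j (mem_index_enum _); rewrite /= mulf_eq0 orbb => /eqP.
by rewrite /V => ->; rewrite mxE.
Qed.

End Algebra.

Section Curves.
Context {R : realType}.

(* Derivative relative to A: at an endpoint of an interval A this is the
   one-sided derivative. *)
Definition diff_quotient {V : normedModType R} (f : R -> V) (t : R) : R -> V :=
  fun s => (s - t)^-1 *: (f s - f t).

Definition is_derive_within {V : normedModType R} (A : set R) (f : R -> V)
    (t : R) (l : V) : Prop :=
  diff_quotient f t @ within A t^' --> l.

Definition derive_within {V : normedModType R} (A : set R) (f : R -> V)
    (t : R) : V :=
  lim (diff_quotient f t @ within A t^').

(* G is C^oo on A x B: D i j is the mixed partial of order i in the first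
   variable and j in the second, all of them existing and being jointly
   continuous up to the boundary. *)
Definition smooth_on {V : normedModType R} (A B : set R) (G : R -> R -> V) :
    Prop :=
  exists D : nat -> nat -> R -> R -> V,
  [/\ forall s t, A s -> B t -> D 0%N 0%N s t = G s t,
      forall i j s t, A s -> B t ->
        is_derive_within A (fun s' => D i j s' t) s (D i.+1 j s t),
      forall i j s t, A s -> B t ->
        is_derive_within B (fun t' => D i j s t') t (D i j.+1 s t) &
      forall i j,
        {within A `*` B, continuous (fun st : R * R => D i j st.1 st.2)}].

Section FixedInterval.
Variables (m n : nat) (t0 t1 : R).

Definition action (Fc : 'M[R]_(m, n) -> 'M[R]_(m, n)) (W : R -> 'M[R]_(m, n)) :
    R :=
  \int[lebesgue_measure]_(t in `[t0, t1])
    (let V := derive_within `[t0, t1] W t in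
     2^-1 * fisher (W t) V V
     + 2^-1 * \sum_i Var (rowc (W t) i) (rowc (Fc (W t)) i)).

Definition assignment_flow_solution (Fc : 'M[R]_(m, n) -> 'M[R]_(m, n))
    (W : R -> 'M[R]_(m, n)) : Prop :=
  forall t, t0 <= t <= t1 ->
    assignment_manifold (W t) /\
    is_derive_within `[t0, t1] W t (replicator (W t) (Fc (W t))).

Definition smooth_variation (W : R -> 'M[R]_(m, n)) (eps : R)
    (G : R -> R -> 'M[R]_(m, n)) : Prop :=
  [/\ smooth_on `]- eps, eps[ `[t0, t1] G,
      forall s t, - eps < s < eps -> t0 <= t <= t1 ->
        assignment_manifold (G s t),
      forall t, t0 <= t <= t1 -> G 0 t = W t &
      forall s, - eps < s < eps -> G s t0 = W t0 /\ G s t1 = W t1].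

Definition critical_point (L : (R -> 'M[R]_(m, n)) -> R)
    (W : R -> 'M[R]_(m, n)) : Prop :=
  forall eps G, 0 < eps -> smooth_variation W eps G ->
    is_derive (0 : R) 1 (fun s => L (G s)) 0.

End FixedInterval.
End Curves.

(* Main.v *)
Require Import Defs.
From HB Require Import structures.
From mathcomp Require Import all_boot all_order all_algebra.
From mathcomp Require Import all_classical all_reals all_analysis.
From mathcomp Require Import ring lra.

Set Implicit Arguments.
Unset Strict Implicit.
Unset Printing Implicit Defensive.

(* One explicit variation W + s V suffices: in a single row, mass s phi is moved
   from the third to the first coordinate, where
   phi = (t - t0)(t1 - t) p^1 p^3. Completing the square, L(W) is half the
   squared distance of W' from the flow field plus the integral of <W', F W>;
   the square vanishes at s = 0 and is nonnegative otherwise, and the second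
   coordinate of the row is unchanged, so
   L(W + s V) - L(W) >= s * int phi (p^2)' with (p^2)' = p^1 p^2 (1 - p^2) > 0.
   The same direction, paired with the skew part of dF, shows that the symmetry
   condition fails at every point. *)

Import Order.TTheory GRing.Theory Num.Theory.
Import numFieldNormedType.Exports.

Local Open Scope classical_set_scope.
Local Open Scope ring_scope.

(** * Entrywise formulas for the replicator operator and the Fisher-Rao metric *)

Section AssignmentAlgebra.
Context {R : realType} {m n : nat}.
Implicit Types (W U V X : 'M[R]_(m, n)) (p x : 'cV[R]_n).

Lemma replicator_mxE p x j :
  (replicator_mx p *m x) j 0 = p j 0 * (x j 0 - \sum_k p k 0 * x k 0).
Proof.
rewrite /replicator_mx mulmxBl -mulmxA mul_diag_mx !mxE big_ord1 !mxE mulrBr.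
by congr (_ - _ * _); apply: eq_bigr => k _; rewrite !mxE.
Qed.

Lemma replicatorE W X i j :
  replicator W X i j = W i j * (X i j - \sum_k W i k * X i k).
Proof.
rewrite mxE replicator_mxE !mxE; congr (_ * (_ - _)).
by apply: eq_bigr => k _; rewrite !mxE.
Qed.

Lemma assignment_manifoldP W :
  assignment_manifold W <->
  (forall i j, 0 < W i j) /\ (forall i, \sum_j W i j = 1).
Proof.
split=> -[W0 W1]; split=> //.
  move=> i; move/matrixP/(_ i 0): W1; rewrite !mxE => <-.
  by apply: eq_bigr => j _; rewrite mxE mulr1.
apply/matrixP => i k; rewrite !mxE -[RHS](W1 i).
by apply: eq_bigr => j _; rewrite mxE mulr1.
Qed.

Lemma replicator_tangent W X :
  assignment_manifold W -> tangent (replicator W X).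
Proof.
move=> /assignment_manifoldP[_ W1]; apply/tangentP => i.
under eq_bigr do rewrite replicatorE mulrBr.
by rewrite sumrB -mulr_suml W1 mul1r subrr.
Qed.

Lemma fisher_ge0 W V : assignment_manifold W -> 0 <= fisher W V V.
Proof.
move=> [W0 _]; apply: sumr_ge0 => i _; apply: sumr_ge0 => j _.
by apply: mulr_ge0; [rewrite -expr2 sqr_ge0 | rewrite invr_ge0 ltW].
Qed.

Lemma fisher0 W V : fisher W 0 V = 0.
Proof. by apply: big1 => i _; apply: big1 => j _; rewrite mxE !mul0r. Qed.

(* The potential term of the action is half the squared Fisher-Rao length of the
   replicator field. *)
Lemma lagrangian_square W V X :
  assignment_manifold W -> tangent V ->
  2^-1 * fisher W V V + 2^-1 * \sum_i Var (rowc W i) (rowc X i) =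
  2^-1 * fisher W (V - replicator W X) (V - replicator W X) + mxdot V X.
Proof.
move=> /assignment_manifoldP[W0 W1] /tangentP V0.
rewrite mxdotE /fisher !mulr_sumr -!big_split /=; apply: eq_bigr => i _.
set c := \sum_k W i k * X i k.
have -> : Var (rowc W i) (rowc X i) = \sum_j W i j * X i j ^+ 2 - c ^+ 2.
  congr (_ - _ ^+ 2); apply: eq_bigr => j _; by rewrite !mxE.
(* The terms are grouped for summation over the row, where [W] sums to 1 and [V] to 0: the first
   bracket sums to [- c ^+ 2], which completes the variance, and the second to minus twice the
   pairing of [V] with [X]. *)
have sq j : (V - replicator W X) i j * (V - replicator W X) i j / W i j =
    V i j * V i j / W i j + W i j * X i j ^+ 2
    + (c ^+ 2 * W i j - (2 * c) * (W i j * X i j))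
    + ((2 * c) * V i j - 2 * (V i j * X i j)).
  have -> : (V - replicator W X) i j = V i j - W i j * (X i j - c).
    by rewrite mxE [X in _ + X]mxE replicatorE.
  by field; rewrite gt_eqF.
under [in RHS]eq_bigr do rewrite sq.
rewrite !big_split /= !sumrN -!mulr_sumr W1 V0 -/c.
by field.
Qed.

(* Since ker R_W consists of the matrices with constant rows, it is orthogonal
   to the tangent space. *)
Lemma replicator_eq0_mxdot W V X :
  assignment_manifold W -> tangent V -> replicator W X = 0 -> mxdot V X = 0.
Proof.
move=> [W0 _] /tangentP V0 RX; rewrite mxdotE big1// => i _.
have XE j : X i j = \sum_k W i k * X i k.
  move/matrixP/(_ i j): RX; rewrite replicatorE mxE => /eqP.
  by rewrite mulf_eq0 gt_eqF//= subr_eq0 => /eqP.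
by under eq_bigr do rewrite XE; rewrite -mulr_suml V0 mul0r.
Qed.

End AssignmentAlgebra.

(** * Limits of finite sums and of matrices *)

Section MatrixLimits.
Context {R : realType} {T : Type} {Fl : set_system T} {FF : Filter Fl}.

Lemma cvg_sum {V : normedModType R} {I : Type} (r : seq I) (P : pred I)
    (f : I -> T -> V) (l : I -> V) :
  (forall i, P i -> f i x @[x --> Fl] --> l i) ->
  \sum_(i <- r | P i) f i x @[x --> Fl] --> \sum_(i <- r | P i) l i.
Proof. by move=> fl; apply: cvg_big fl; exact: add_continuous. Qed.

(** A matrix is a finite combination of the [delta_mx], so entrywise limits suffice. *)
Lemma cvg_mx m n (f : T -> 'M[R]_(m, n)) (l : 'M[R]_(m, n)) :
  (forall i j, f x i j @[x --> Fl] --> l i j) -> f @ Fl --> l.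
Proof.
move=> fl; rewrite [l]matrix_sum_delta.
rewrite (_ : f = fun x => \sum_i \sum_j f x i j *: delta_mx i j); last first.
  by apply/funext => x; exact: matrix_sum_delta.
by apply: cvg_sum => i _; apply: cvg_sum => j _; apply: cvgZr_tmp.
Qed.

End MatrixLimits.

Lemma mxdotC {R : realType} {m n : nat} (A B : 'M[R]_(m, n)) :
  mxdot A B = mxdot B A.
Proof.
by rewrite !mxdotE; apply: eq_bigr => i _; apply: eq_bigr => j _; rewrite mulrC.
Qed.

(** * The affinity map of F = e_j e_i^T, and differentials of row-wise linear maps *)

Section ElementaryAffinity.
Context {R : realType} {m n : nat}.
Implicit Types (W V : 'M[R]_(m, n)) (i j : 'I_n).

Lemma elementary_mul_col i j (p : 'cV[R]_n) :
  std_basis j *m (std_basis i)^T *m p = p i 0 *: std_basis j.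
Proof.
rewrite -mulmxA (_ : _ *m p = (p i 0)%:M) ?mul_mx_scalar//.
apply/matrixP => k l; rewrite !ord1 !mxE eqxx mulr1n (bigD1 i)//= !mxE !eqxx mul1r.
by rewrite big1 ?addr0// => q qi; rewrite !mxE (negbTE qi) mul0r.
Qed.

Lemma rowwise_elementaryE i j W k l :
  rowwise (std_basis j *m (std_basis i)^T) W k l = (l == j)%:R * W k i.
Proof. by rewrite mxE elementary_mul_col !mxE eqxx andbT mulrC. Qed.

Lemma replicator_elementaryE i j W k l :
  replicator W (rowwise (std_basis j *m (std_basis i)^T) W) k l =
  W k l * (W k i * ((l == j)%:R - W k j)).
Proof.
rewrite replicatorE; under eq_bigr do rewrite rowwise_elementaryE.
rewrite rowwise_elementaryE (bigD1 j)//= eqxx mul1r big1 ?addr0; first by ring.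
by move=> q qj; rewrite (negbTE qj) mul0r mulr0.
Qed.

Lemma mxdot_elementary i j V W :
  mxdot V (rowwise (std_basis j *m (std_basis i)^T) W) = \sum_k V k j * W k i.
Proof.
rewrite mxdotE; apply: eq_bigr => k _.
under eq_bigr do rewrite rowwise_elementaryE.
rewrite (bigD1 j)//= eqxx mul1r big1 ?addr0// => l lj.
by rewrite (negbTE lj) mul0r mulr0.
Qed.

Lemma rowwiseE (F : 'M[R]_n) W k l : rowwise F W k l = \sum_q F l q * W k q.
Proof. by rewrite !mxE; apply: eq_bigr => q _; rewrite !mxE. Qed.

Lemma rowwise_is_linear (F : 'M[R]_n) :
  linear (rowwise F : 'M[R]_(m, n) -> 'M[R]_(m, n)).
Proof.
move=> a U V; apply/matrixP => i j.
rewrite [RHS]mxE [X in _ = X + _]mxE !rowwiseE mulr_sumr -big_split.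
by apply: eq_bigr => k _; rewrite !mxE /=; ring.
Qed.

(** The linear structure lets [diff_lin] identify the differential of [rowwise F] with the map
    itself. *)
HB.instance Definition _ (F : 'M[R]_n) :=
  GRing.isLinear.Build R 'M[R]_(m, n) 'M[R]_(m, n) *:%R (rowwise F)
    (rowwise_is_linear F).

Lemma rowwise_continuous (F : 'M[R]_n) :
  continuous (rowwise F : 'M[R]_(m, n) -> 'M[R]_(m, n)).
Proof.
move=> W; apply: (@cvg_mx _ _ (nbhs W)) => i j; rewrite rowwiseE.
under eq_fun do rewrite rowwiseE.
apply: cvg_sum => k _; apply: cvgM; first exact: cvg_cst.
exact: coord_continuous.
Qed.

Lemma diff_rowwise (F : 'M[R]_n) W :
  'd (rowwise F : 'M[R]_(m, n) -> 'M[R]_(m, n)) W = rowwise F :> (_ -> _).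
Proof. exact/diff_lin/rowwise_continuous. Qed.

End ElementaryAffinity.

(** * Moving mass between two coordinates of a single row *)

Section MassShift.
Context {R : realType} {m n : nat}.

(** A positive multiple moves mass from coordinate [k] to coordinate [i]; the suffixes [src] and
    [dst] below stand for coordinates [i] and [k]. *)
Definition mass_shift (r : 'I_m) (i k : 'I_n) : 'M[R]_(m, n) :=
  delta_mx r i - delta_mx r k.

Lemma mass_shift_tangent r i k : tangent (mass_shift r i k).
Proof.
apply/tangentP => q; under eq_bigr do rewrite !mxE.
rewrite sumrB (bigD1 i)//= eqxx andbT big1 => [|j ji]; last first.
  by rewrite (negbTE ji) andbF.
rewrite addr0 (bigD1 k)//= eqxx andbT big1 => [|j jk]; last first.
  by rewrite (negbTE jk) andbF.
by rewrite addr0 subrr.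
Qed.

Lemma mass_shift_src (r : 'I_m) (i k : 'I_n) q : i != k -> mass_shift r i k q i = (q == r)%:R.
Proof. by move=> ik; rewrite !mxE eqxx (negbTE ik) andbT andbF subr0. Qed.

Lemma mass_shift_dst (r : 'I_m) (i k : 'I_n) q : i != k -> mass_shift r i k q k = - (q == r)%:R.
Proof.
by rewrite eq_sym => ik; rewrite !mxE eqxx (negbTE ik) andbT andbF sub0r.
Qed.

Lemma mass_shift_eq0 (r : 'I_m) (i k l : 'I_n) q :
  l != i -> l != k -> mass_shift r i k q l = 0.
Proof. by move=> li lk; rewrite !mxE (negbTE li) (negbTE lk) andbF subrr. Qed.

(** The factor [W r i * W r k] turns the two changed entries into [W r i * (1 + c * W r k)] and
    [W r k * (1 - c * W r i)]. Both are positive because entries of [W] are at most 1. *)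
Lemma assignment_manifold_shift (W : 'M[R]_(m, n)) r (i k : 'I_n) c :
  i != k -> assignment_manifold W -> `|c| < 1 ->
  assignment_manifold (W + (c * (W r i * W r k)) *: mass_shift r i k).
Proof.
move=> ik /assignment_manifoldP[W0 W1] c1; apply/assignment_manifoldP; split.
  have Wle1 q l : W q l <= 1.
    by rewrite -(W1 q) (bigD1 l)//= lerDl; apply: sumr_ge0 => ? _; apply/ltW.
  have factor q l d : `|d| < 1 -> 0 < 1 + d * W q l.
    move=> d1; rewrite -[d * _]opprK subr_gt0 (le_lt_trans (ler_norm _))//.
    by rewrite normrN normrM (le_lt_trans _ d1)// ler_piMr// gtr0_norm.
  move=> q l; rewrite mxE [X in _ + X]mxE.
  have [->|li] := eqVneq l i.
    rewrite mass_shift_src//; have [->|_] := eqVneq q r; last first.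
      by rewrite mulr0 addr0.
    rewrite (_ : _ + _ = W r i * (1 + c * W r k)) ?mulr_gt0 ?factor//.
    by rewrite /=; ring.
  have [->|lk] := eqVneq l k; last by rewrite mass_shift_eq0// mulr0 addr0.
  rewrite mass_shift_dst//; have [->|_] := eqVneq q r; last first.
    by rewrite oppr0 mulr0 addr0.
  rewrite (_ : _ + _ = W r k * (1 + (- c) * W r i)).
    by rewrite mulr_gt0 ?factor ?normrN.
  by rewrite /=; ring.
move=> q; have /tangentP E0 := mass_shift_tangent r i k.
under eq_bigr do rewrite mxE [X in _ + X]mxE.
by rewrite big_split /= -mulr_sumr E0 mulr0 addr0.
Qed.

(** Together with positivity of the third coordinate this yields 1 - p^i - p^j > 0. *)
Lemma simplex_sum3_le1 (p : 'cV[R]_n) (i j k : 'I_n) :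
  simplex p -> i != j -> i != k -> j != k -> p i 0 + p j 0 + p k 0 <= 1.
Proof.
move=> [p0 <-] ij ik jk.
rewrite (bigD1 i)//= (bigD1 j) 1?eq_sym//= (bigD1 k) /=; last first.
  by rewrite eq_sym ik eq_sym jk.
by rewrite !addrA lerDl; apply: sumr_ge0 => l _; apply/ltW.
Qed.

End MassShift.

(** * Failure of the symmetry condition for F = e_j e_i^T *)

Section ElementaryAffinityAssignmentFlow.
Context {R : realType} {m n : nat}.
Variables i j : 'I_n.
Hypothesis ij : i != j.
Let F : 'M[R]_n := std_basis j *m (std_basis i)^T.

(** With y = R_p F p, the skew part maps y to y^i e_j - y^j e_i. Hence coordinate i of the result
    depends only on y^i = -(p^i)^2 p^j and y^j = p^i p^j (1 - p^j). *)
Lemma skew_elementary_replicator (p : 'cV[R]_n) :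
  (replicator_mx p *m (F - F^T) *m replicator_mx p *m F *m p) i 0 =
  - (p i 0 ^+ 2 * p j 0 * (1 - p i 0 - p j 0)).
Proof.
have -> : replicator_mx p *m (F - F^T) *m replicator_mx p *m F *m p =
    replicator_mx p *m ((F - F^T) *m (replicator_mx p *m (F *m p))).
  by rewrite !mulmxA.
rewrite elementary_mul_col replicator_mxE.
set y := replicator_mx p *m _.
have sumj (a : R) (f : 'I_n -> R) l : \sum_k f k * ((k == l)%:R * a) = f l * a.
  rewrite (bigD1 l)//= eqxx mul1r big1 ?addr0// => k kl.
  by rewrite (negbTE kl) mul0r mulr0.
have yE k : y k 0 = p k 0 * (((k == j)%:R - p j 0) * p i 0).
  rewrite replicator_mxE !mxE andbT.
  under eq_bigr do rewrite !mxE andbT [p i 0 * _]mulrC.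
  by rewrite sumj; ring.
have FvE (v : 'cV[R]_n) k :
    ((F - F^T) *m v) k 0 = (k == j)%:R * v i 0 - (k == i)%:R * v j 0.
  rewrite mulmxBl trmx_mul trmxK !elementary_mul_col !mxE !andbT.
  by rewrite [v i 0 * _]mulrC [v j 0 * _]mulrC.
under eq_bigr do rewrite FvE mulrBr.
rewrite sumrB !sumj FvE !yE eqxx (negbTE ij) eqxx /=.
ring.
Qed.

(** The entry equals [W r j * W r i * (1 - W r j)], and the last factor is at least [W r i], since
    columns [i] and [j] differ. *)
Lemma elementary_growth_gt0 (W : 'M[R]_(m, n)) (r : 'I_m) :
  assignment_manifold W -> 0 < replicator W (rowwise F W) r j.
Proof.
move=> /assignment_manifoldP[W0 W1].
rewrite replicator_elementaryE eqxx !mulr_gt0// subr_gt0.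
rewrite -(W1 r) (bigD1 j)//= ltrDl (bigD1 i)//= ltr_wpDr//.
by apply: sumr_ge0 => q _; apply/ltW.
Qed.

(** If the image vanished, the skew part applied to [Y] would be orthogonal to the mass shift E. But
    E is zero in column [j], so the pairing of E with F Y is 0, while its pairing with the adjoint
    term is that of F E with [Y], namely [Y r j], which is positive. *)
Lemma skew_replicator_neq0 (k : 'I_n) (W : 'M[R]_(m, n)) (r : 'I_m) :
  i != k -> j != k -> assignment_manifold W ->
  let Fc : 'M[R]_(m, n) -> 'M[R]_(m, n) := rowwise F in
  let Y := replicator W (Fc W) in
  replicator W ('d Fc W Y - adjoint ('d Fc W) Y) <> 0.
Proof.
move=> ik jk WM Fc Y RZ0.
have E0 : tangent (mass_shift r i k : 'M[R]_(m, n)) := mass_shift_tangent r i k.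
have [_ adjP] := is_adjointP ('d Fc W).
have := replicator_eq0_mxdot WM E0 RZ0.
rewrite {1}/mxdot mulmxBr linearB /= -/(mxdot _ _) -/(mxdot _ _).
rewrite -(adjP _ _ E0) diff_rowwise [X in _ - X]mxdotC !mxdot_elementary.
rewrite big1 => [|q _]; last by rewrite mass_shift_eq0 ?mul0r// eq_sym.
rewrite (bigD1 r)//= mass_shift_src// eqxx mulr1 big1 => [|q qr]; last first.
  by rewrite mass_shift_src// (negbTE qr) mulr0.
apply/eqP; rewrite addr0 sub0r oppr_eq0 gt_eqF//.
exact: elementary_growth_gt0.
Qed.

End ElementaryAffinityAssignmentFlow.

(** * Calculus of derivatives relative to a set *)

Section WithinDerivative.
Context {R : realType} {V : normedModType R}.
Implicit Types (A : set R) (t : R).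

Lemma within_dnbhsW A t : within A t^' `=>` within A (nbhs t).
Proof.
move=> P; rewrite /dnbhs /within /=; apply: filterS => s Ps _; exact: Ps.
Qed.

Lemma within_dnbhs_eq {T : Type} A (f g : R -> T) t :
  (forall s, s != t -> f s = g s) -> {near within A t^', f =1 g}.
Proof.
move=> fg; rewrite near_withinE /dnbhs near_withinE.
by apply: nearW => s st _; exact: fg.
Qed.

(** Off [t], f s = f t + (s - t) times the difference quotient, which gives the punctured limit. The
    point [t] itself is then added back, as [f t] lies in each of its neighbourhoods. *)
Lemma is_derive_within_continuous A (f : R -> V) t l :
  is_derive_within A f t l -> f @ within A (nbhs t) --> f t.
Proof.
move=> fl.
have ft : f @ within A t^' --> f t.
  have -> : f t = f t + (t - t) *: l by rewrite subrr scale0r addr0.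
  apply: (@cvg_trans _ ((fun s => f t + (s - t) *: diff_quotient f t s)
      @ within A t^')).
    apply: near_eq_cvg; apply: within_dnbhs_eq => s st.
    by rewrite /diff_quotient scalerA divff ?subr_eq0// scale1r addrC subrK.
  apply: cvgD; first exact: cvg_cst.
  apply: cvgZ fl; apply: cvgB; last exact: cvg_cst.
  exact: cvg_trans (@within_dnbhsW _ _) (cvg_within _).
move=> U Ut.
have fU : \forall s \near t, s != t -> A s -> U (f s) := ft _ Ut.
apply: filterS fU => s fU As.
have [st|st] := eqVneq s t; last exact: fU.
by rewrite st; exact: nbhs_singleton Ut.
Qed.

Lemma is_derive_within_cst A (v : V) t : is_derive_within A (fun=> v) t 0.
Proof.
rewrite /is_derive_within /diff_quotient.
under eq_fun do rewrite subrr scaler0.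
exact: cvg_cst.
Qed.

Lemma is_derive_withinD A (f g : R -> V) t l k :
  is_derive_within A f t l -> is_derive_within A g t k ->
  is_derive_within A (fun s => f s + g s) t (l + k).
Proof.
move=> fl gk; rewrite /is_derive_within /diff_quotient.
under eq_fun do rewrite opprD addrACA scalerDr.
exact: cvgD.
Qed.

Lemma is_derive_within_scale A (f : R -> R) (v : V) t l :
  is_derive_within A f t l -> is_derive_within A (fun s => f s *: v) t (l *: v).
Proof.
move=> fl; rewrite /is_derive_within /diff_quotient.
under eq_fun do rewrite -scalerBl scalerA.
exact: cvgZr_tmp.
Qed.

End WithinDerivative.

(** * Product rule, matrix entries, and uniqueness of the derivative on an interval *)

Section WithinDerivativeScalar.
Context {R : realType}.
Implicit Types (A : set R) (t : R).

Lemma is_derive_within_id A t : is_derive_within A (@id R) t 1.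
Proof.
apply: (@cvg_trans _ ((fun=> 1 : R) @ within A t^')); last exact: cvg_cst.
apply: near_eq_cvg; apply: within_dnbhs_eq => s st.
by rewrite /diff_quotient /GRing.scale /= mulVf// subr_eq0.
Qed.

Lemma is_derive_withinM A (f g : R -> R) t l k :
  is_derive_within A f t l -> is_derive_within A g t k ->
  is_derive_within A (fun s => f s * g s) t (l * g t + f t * k).
Proof.
move=> fl gk.
have fc : f @ within A t^' --> f t.
  apply: cvg_trans (is_derive_within_continuous fl).
  exact/cvg_app/within_dnbhsW.
rewrite /is_derive_within (_ : diff_quotient _ t =
  fun s => diff_quotient f t s * g t + f s * diff_quotient g t s).
  by apply: cvgD; apply: cvgM => //; exact: cvg_cst.
by apply/funext => s; rewrite /diff_quotient /GRing.scale /=; ring.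
Qed.

Lemma is_derive_within_coord m n A (f : R -> 'M[R]_(m, n)) t (l : 'M[R]_(m, n)) i j :
  is_derive_within A f t l -> is_derive_within A (fun s => f s i j) t (l i j).
Proof.
move=> fl; rewrite /is_derive_within.
rewrite (_ : diff_quotient _ t = (fun M : 'M[R]_(m, n) => M i j)
    \o diff_quotient f t); last by apply/funext => s; rewrite /= !mxE.
apply: (@cvg_comp _ _ _ _ _ _ (nbhs l)); [exact: fl | exact: coord_continuous].
Qed.

Lemma is_derive_within_mx m n A (f : R -> 'M[R]_(m, n)) t (l : 'M[R]_(m, n)) :
  (forall i j, is_derive_within A (fun s => f s i j) t (l i j)) ->
  is_derive_within A f t l.
Proof.
move=> fl; apply: cvg_mx => i j.
by under eq_fun do rewrite !mxE; exact: fl.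
Qed.

(** Properness makes limits unique, so that [derive_within] returns the actual derivative. Points of
    the interval accumulate at [t] from the right if [t < b] and from the left if [t = b]. *)
Lemma within_itv_proper (a b t : R) :
  a < b -> t \in `[a, b] -> ProperFilter (within `[a, b] t^').
Proof.
move=> ab; rewrite in_itv /= => /andP[at_ tb].
apply: Build_ProperFilter => F0.
have {}F0 : \forall s \near t, s != t -> s \in `[a, b] -> False := F0.
have [tb'|bt] := ltP t b.
  have [s [Fs ts sb]] : exists s, [/\ s != t -> s \in `[a, b] -> False, t < s &
      s < b].
    apply: (@filter_ex _ t^'+); near=> s; split; near: s.
    - exact: cvg_within F0.
    - exact: nbhs_right_gt.
    - exact: nbhs_right_lt.
  apply: Fs; first by rewrite gt_eqF.
  by rewrite in_itv /= (ltW sb) (le_trans at_ (ltW ts)).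
have at' : a < t by exact: lt_le_trans bt.
have [s [Fs st sa]] : exists s, [/\ s != t -> s \in `[a, b] -> False, s < t &
    a < s].
  apply: (@filter_ex _ t^'-); near=> s; split; near: s.
  - exact: cvg_within F0.
  - exact: nbhs_left_lt.
  - exact: nbhs_left_gt.
apply: Fs; first by rewrite lt_eqF.
by rewrite in_itv /= (ltW sa) (le_trans (ltW st) tb).
Unshelve. all: by end_near. Qed.

Lemma derive_withinE (a b t : R) {V : normedModType R} (f : R -> V) l :
  a < b -> t \in `[a, b] -> is_derive_within `[a, b] f t l ->
  derive_within `[a, b] f t = l.
Proof.
by move=> ab tab fl; have FF := within_itv_proper ab tab; exact: norm_cvg_lim.
Qed.

Lemma within_continuous_snd {V : normedModType R} A (B : set R) (f : R -> V) :
  {within B, continuous f} ->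
  {within A `*` B, continuous (fun st : R * R => f st.2)}.
Proof.
move/subspace_continuousP => fc; apply/subspace_continuousP => -[s t] [_ Bt].
apply: (@cvg_comp _ _ _ snd f _ (within B (nbhs t))); last exact: fc.
move=> P BP; exists (setT, [set y | B y -> P y]) => /=.
  by split; [exact: filterT | exact: BP].
by move=> [x y] /= [_ Py] [_ By]; exact: Py.
Qed.

End WithinDerivativeScalar.

(** * Strict positivity of an integral, and a one-sided obstruction to a zero derivative *)

Section RealAnalysis.
Context {R : realType}.
Notation mu := (@lebesgue_measure R).

Lemma itv_continuous_integrable (a b : R) (f : R -> R) :
  {within `[a, b], continuous f} -> mu.-integrable `[a, b] (EFin \o f).
Proof.
by move=> fc; apply: continuous_compact_integrable => //; exact: segment_compact.
Qed.

(** A zero integral would force f = 0 almost everywhere, making the open interval negligible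
    although its measure is b - a > 0. Strict positivity is asked only in the interior because the
    bump used later vanishes at the endpoints. *)
Lemma Rintegral_gt0 (a b : R) (f : R -> R) : a < b ->
  {within `[a, b], continuous f} -> {in `[a, b], forall t, 0 <= f t} ->
  {in `]a, b[, forall t, 0 < f t} -> 0 < \int[mu]_(t in `[a, b]) f t.
Proof.
move=> ab fc f0 fgt0.
have fi := itv_continuous_integrable fc.
rewrite lt_def Rintegral_ge0 ?andbT; last by move=> t tab; exact: f0.
apply/eqP => If0.
have abs0 : (\int[mu]_(t in `[a, b]) `|(EFin \o f) t| = 0)%E.
  transitivity (\int[mu]_(t in `[a, b]) (EFin \o f) t)%E.
    apply: eq_integral => t; rewrite inE => tab.
    by rewrite gee0_abs// lee_fin f0.
  rewrite -(fineK (integrable_fin_num _ fi))//.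
  by move: If0; rewrite /Rintegral => ->.
have mI : measurable (`[a, b] : set R) by [].
have /(ae_eq_integral_abs mu mI (measurable_int _ fi)) fae := abs0.
have neg : mu.-negligible (`]a, b[ : set R).
  apply: negligibleS fae => t /= tab /(_ (subset_itv_oo_cc tab)) /eqP.
  by rewrite eqe gt_eqF// fgt0.
have mJ : measurable (`]a, b[ : set R) by [].
have /eqP : mu `]a, b[%classic = 0%E by exact/(negligibleP mu mJ).
rewrite lebesgue_measure_itv /= lte_fin ab.
by rewrite -EFinB eqe subr_eq0 gt_eqF.
Qed.

(** All right difference quotients at 0 are at least [kappa], hence so is any derivative there. A
    lower bound on the action thus suffices, without computing its first variation. *)
Lemma is_derive_zero_no_growth (h : R -> R) (eps kappa : R) :
  0 < eps -> 0 < kappa ->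
  (forall s, 0 < s < eps -> s * kappa <= h s - h 0) ->
  ~ is_derive (0 : R) 1 h 0.
Proof.
move=> eps0 kappa0 hk [hd hD].
have := cvg_dnbhs_at_right hd.
rewrite -/(derive h 0 1) hD => hc.
suff : kappa <= 0 by rewrite leNgt kappa0.
apply: (cvgr_to_ge hc); near=> s.
have s0 : 0 < s by near: s; exact: nbhs_right_gt.
have se : s < eps by near: s; exact: nbhs_right_lt.
rewrite /GRing.scale /= mulr1 addr0 mulrC ler_pdivlMr// mulrC hk//.
by rewrite s0.
Unshelve. all: by end_near. Qed.

End RealAnalysis.

(** * Continuity of the Lagrangian *)

Section LagrangianContinuity.
Context {R : realType} {m n : nat} {T : Type} {Fl : set_system T}
  {FF : Filter Fl}.

Lemma cvg_coord (W : T -> 'M[R]_(m, n)) (w : 'M[R]_(m, n)) i j :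
  W @ Fl --> w -> W x i j @[x --> Fl] --> w i j.
Proof.
move=> Ww; apply: (@cvg_comp _ _ _ W (fun M : 'M[R]_(m, n) => M i j)).
  exact: Ww.
exact: coord_continuous.
Qed.

(** The Lagrangian is rational in the entries, and its only non-constant denominators are the
    entries of [W]. *)
Lemma cvg_lagrangian (W V X : T -> 'M[R]_(m, n)) (w v x : 'M[R]_(m, n)) :
  (forall i j, w i j != 0) ->
  W @ Fl --> w -> V @ Fl --> v -> X @ Fl --> x ->
  2^-1 * fisher (W t) (V t) (V t)
    + 2^-1 * \sum_i Var (rowc (W t) i) (rowc (X t) i) @[t --> Fl] -->
  2^-1 * fisher w v v + 2^-1 * \sum_i Var (rowc w i) (rowc x i).
Proof.
move=> w0 Ww Vv Xx.
have VarE (A B : 'M[R]_(m, n)) i : Var (rowc A i) (rowc B i) =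
    \sum_j A i j * (B i j * B i j)
    - (\sum_j A i j * B i j) * (\sum_j A i j * B i j).
  rewrite /Var expr2; congr (_ - _ * _); apply: eq_bigr => j _; rewrite !mxE//.
apply: cvgD; apply: cvgM; try exact: cvg_cst; apply: cvg_sum => i _.
  apply: cvg_sum => j _; apply: cvgM; last first.
    by apply: cvgV => //; exact: cvg_coord.
  by apply: cvgM; exact: cvg_coord.
rewrite VarE; under eq_fun do rewrite VarE.
by apply: cvgB; [|apply: cvgM]; apply: cvg_sum => j _; apply: cvgM;
  (try apply: cvgM); exact: cvg_coord.
Qed.

End LagrangianContinuity.

(** * Smoothness of flow solutions and of their perturbations *)

Section FlowPolynomials.
Context {R : realType} {m n : nat}.
Variables (i j : 'I_n).

(* Polynomials in t and the entries of W are stable under derivation along the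
   flow; this gives the smoothness of solutions. *)
Inductive flow_poly :=
  | FTime | FCst of R | FEntry of 'I_m & 'I_n
  | FAdd of flow_poly & flow_poly | FMul of flow_poly & flow_poly.

Fixpoint flow_eval (W : R -> 'M[R]_(m, n)) (e : flow_poly) (t : R) : R :=
  match e with
  | FTime => t
  | FCst c => c
  | FEntry p q => W t p q
  | FAdd e1 e2 => flow_eval W e1 t + flow_eval W e2 t
  | FMul e1 e2 => flow_eval W e1 t * flow_eval W e2 t
  end.

(** The [FEntry] case substitutes the right-hand side of the flow, in the form given by
    [replicator_elementaryE]. *)
Fixpoint flow_deriv (e : flow_poly) : flow_poly :=
  match e with
  | FTime => FCst 1
  | FCst _ => FCst 0
  | FEntry p q => FMul (FEntry p q) (FMul (FEntry p i)
      (FAdd (FCst (q == j)%:R) (FMul (FCst (-1)) (FEntry p j))))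
  | FAdd e1 e2 => FAdd (flow_deriv e1) (flow_deriv e2)
  | FMul e1 e2 => FAdd (FMul (flow_deriv e1) e2) (FMul e1 (flow_deriv e2))
  end.

Variables (t0 t1 : R) (W : R -> 'M[R]_(m, n)).
Let F : 'M[R]_n := std_basis j *m (std_basis i)^T.
Hypothesis Wflow : assignment_flow_solution t0 t1 (rowwise F) W.

Lemma flow_deriv_entryE p q t :
  flow_eval W (flow_deriv (FEntry p q)) t =
  replicator (W t) (rowwise F (W t)) p q.
Proof. by rewrite replicator_elementaryE /= mulN1r. Qed.

Lemma is_derive_within_flow_eval e t : t \in `[t0, t1] ->
  is_derive_within `[t0, t1] (flow_eval W e) t (flow_eval W (flow_deriv e) t).
Proof.
move=> tI; elim: e => [|c|p q|e1 IH1 e2 IH2|e1 IH1 e2 IH2].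
- exact: is_derive_within_id.
- exact: is_derive_within_cst.
- have [_ /is_derive_within_coord dW] := Wflow tI.
  by rewrite flow_deriv_entryE; exact: dW.
- exact: is_derive_withinD.
- exact: is_derive_withinM.
Qed.

Lemma flow_eval_continuous e : {within `[t0, t1], continuous (flow_eval W e)}.
Proof.
apply/subspace_continuousP => t tI.
exact: (is_derive_within_continuous (is_derive_within_flow_eval tI)).
Qed.

Definition flow_derivs (k : nat) (t : R) : 'M[R]_(m, n) :=
  \matrix_(p, q) flow_eval W (iter k flow_deriv (FEntry p q)) t.

Lemma is_derive_within_flow_derivs k t : t \in `[t0, t1] ->
  is_derive_within `[t0, t1] (flow_derivs k) t (flow_derivs k.+1 t).
Proof.
move=> tI; apply: is_derive_within_mx => p q; rewrite mxE iterS.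
rewrite (_ : (fun s => _) = flow_eval W (iter k flow_deriv (FEntry p q))).
  exact: is_derive_within_flow_eval.
by apply/funext => s; rewrite mxE.
Qed.

Definition flow_perturbation (e : flow_poly) (E : 'M[R]_(m, n)) (s t : R) :=
  W t + (s * flow_eval W e t) *: E.

Lemma is_derive_within_perturbation e E s t : t \in `[t0, t1] ->
  is_derive_within `[t0, t1] (flow_perturbation e E s) t
    (replicator (W t) (rowwise F (W t))
     + (s * flow_eval W (flow_deriv e) t) *: E).
Proof.
move=> tI; apply: is_derive_withinD; first by have [] := Wflow tI.
apply: is_derive_within_scale.
have := is_derive_within_flow_eval (e := FMul (FCst s) e) tI.
by rewrite /= mul0r add0r.
Qed.

Lemma smooth_on_perturbation e E (S : set R) :
  smooth_on S `[t0, t1] (flow_perturbation e E).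
Proof.
pose Phi k t := flow_eval W (iter k flow_deriv e) t.
(* The perturbation is affine in [s]: the first derivative in [s] removes the solution and the
   factor [s], and all later ones vanish. Derivatives in [t] are iterates of [flow_deriv]. *)
exists (fun a k s t => match a with
  | 0 => flow_derivs k t + (s * Phi k t) *: E
  | 1 => Phi k t *: E
  | _ => 0
  end).
split.
- move=> s t _ _; congr (_ + _).
  by apply/matrixP => p q; rewrite mxE.
- move=> [|[|a]] k s t _ tI; last 2 first.
  + exact: is_derive_within_cst.
  + exact: is_derive_within_cst.
  rewrite -[X in is_derive_within _ _ _ X]add0r.
  apply: is_derive_withinD; first exact: is_derive_within_cst.
  apply: is_derive_within_scale.
  have := is_derive_withinM (is_derive_within_id S s)
    (is_derive_within_cst S (Phi k t) s).
  by rewrite mul1r mulr0 addr0.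
- move=> [|[|a]] k s t _ tI; last exact: is_derive_within_cst.
  + apply: is_derive_withinD; first exact: is_derive_within_flow_derivs.
    apply: is_derive_within_scale.
    have := is_derive_within_flow_eval (e := FMul (FCst s) (iter k flow_deriv e)) tI.
    by rewrite /= mul0r add0r.
  + by apply: is_derive_within_scale; exact: is_derive_within_flow_eval.
- move=> [|[|a]] k; last exact: cst_continuous.
  + apply/subspace_continuousP => st stI.
    have Wc : {within S `*` `[t0, t1], continuous (fun st => flow_derivs k st.2)}.
      apply: within_continuous_snd; apply/subspace_continuousP => t tI.
      exact: (is_derive_within_continuous (is_derive_within_flow_derivs tI)).
    have Pc : {within S `*` `[t0, t1], continuous (fun st => Phi k st.2)}.
      by apply: within_continuous_snd; exact: flow_eval_continuous.
    apply: cvgD; first by move/subspace_continuousP: Wc; exact.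
    apply: cvgZr_tmp; apply: cvgM.
      by case: st stI => x y _; apply: cvg_within_filter; exact: cvg_fst.
    by move/subspace_continuousP: Pc; exact.
  + apply/subspace_continuousP => st stI; apply: cvgZr_tmp.
    have Pc : {within S `*` `[t0, t1], continuous (fun st => Phi k st.2)}.
      by apply: within_continuous_snd; exact: flow_eval_continuous.
    by move/subspace_continuousP: Pc; exact.
Qed.

End FlowPolynomials.

Arguments FTime {R m n}.
Arguments FCst {R m n}.
Arguments FEntry {R m n}.

(** * Growth of the action along the mass-shift variation *)

Section FirstVariation.
Context {R : realType} {m n : nat}.
Variables (i j k : 'I_n) (r : 'I_m) (t0 t1 : R) (W : R -> 'M[R]_(m, n)).
Hypotheses (ij : i != j) (ik : i != k) (jk : j != k) (t01 : t0 < t1).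
Let F : 'M[R]_n := std_basis j *m (std_basis i)^T.
Let Fc : 'M[R]_(m, n) -> 'M[R]_(m, n) := rowwise F.
Hypothesis Wflow : assignment_flow_solution t0 t1 Fc W.
Let E : 'M[R]_(m, n) := mass_shift r i k.

(** The time factor fixes the endpoints, the factor [W r i * W r k] is the one in
    [assignment_manifold_shift], and the encoding as a [flow_poly] provides smoothness. *)
Definition bump_poly : @flow_poly R m n :=
  FMul (FMul (FAdd FTime (FCst (- t0))) (FAdd (FCst t1) (FMul (FCst (-1)) FTime)))
       (FMul (FEntry r i) (FEntry r k)).
(* This bounds |s (t - t0)(t1 - t)| by 1. *)
Let eps := ((t1 - t0) ^+ 2)^-1.
Let phi := flow_eval W bump_poly.
Let phi' := flow_eval W (flow_deriv i j bump_poly).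
Let G := flow_perturbation W bump_poly E.

Let W_manifold t : t \in `[t0, t1] -> assignment_manifold (W t).
Proof. by move=> tI; have [] := Wflow tI. Qed.

Let phiE t : phi t = (t - t0) * (t1 - t) * (W t r i * W t r k).
Proof. by rewrite /phi /= mulN1r. Qed.

Let G_manifold s t : - eps < s < eps -> t \in `[t0, t1] ->
  assignment_manifold (G s t).
Proof.
move=> se tI; rewrite /G /flow_perturbation -/phi phiE mulrA.
apply: assignment_manifold_shift; [exact: ik | exact: W_manifold|].
have {}se : `|s| < eps by rewrite ltr_norml.
move: tI; rewrite in_itv /= => /andP[at_ tb].
have d0 : 0 < (t1 - t0) ^+ 2 by rewrite exprn_gt0// subr_gt0.
have b0 : 0 <= (t - t0) * (t1 - t) by rewrite mulr_ge0// subr_ge0.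
rewrite normrM (ger0_norm b0).
apply: (@le_lt_trans _ _ (`|s| * (t1 - t0) ^+ 2)).
  by rewrite ler_wpM2l// expr2 ler_pM ?subr_ge0// ?lerB// lerD2.
by rewrite -ltr_pdivlMr// mul1r.
Qed.

Lemma smooth_variation_bump : smooth_variation t0 t1 W eps G.
Proof.
split.
- exact: smooth_on_perturbation Wflow _ _ _.
- by move=> s t se tI; exact: G_manifold.
- by move=> t _; rewrite /G /flow_perturbation mul0r scale0r addr0.
- move=> s _; rewrite /G /flow_perturbation -/phi !phiE !subrr.
  by rewrite mulr0 !mul0r mulr0 scale0r !addr0.
Qed.

Let lag s t : R :=
  let V := derive_within `[t0, t1] (G s) t in
  2^-1 * fisher (G s t) V V
  + 2^-1 * \sum_i Var (rowc (G s t) i) (rowc (Fc (G s t)) i).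

Let velocity s t : 'M[R]_(m, n) :=
  replicator (W t) (Fc (W t)) + (s * phi' t) *: E.

Let derive_G s t : t \in `[t0, t1] ->
  derive_within `[t0, t1] (G s) t = velocity s t.
Proof.
move=> tI; apply: derive_withinE => //.
exact: (is_derive_within_perturbation Wflow).
Qed.

Let lag_continuous s : - eps < s < eps -> {within `[t0, t1], continuous (lag s)}.
Proof.
move=> se.
have phic e : {within `[t0, t1], continuous (flow_eval W e)}.
  exact: flow_eval_continuous Wflow _.
have Vc : {within `[t0, t1], continuous (velocity s)}.
  apply/subspace_continuousP => t tI; apply: cvg_mx => p q.
  (* Each entry of the velocity is itself a flow polynomial, hence continuous on the interval. *)
  pose e := FAdd (flow_deriv i j (FEntry p q))
    (FMul (FMul (FCst s) (flow_deriv i j bump_poly)) (FCst (E p q))).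
  have veE u : velocity s u p q = flow_eval W e u.
    by rewrite mxE [X in _ + X]mxE -flow_deriv_entryE.
  rewrite veE; under eq_fun do rewrite veE.
  by have /subspace_continuousP := phic e; exact.
have Gc : {within `[t0, t1], continuous (G s)}.
  apply/subspace_continuousP => t tI.
  exact: (is_derive_within_continuous (is_derive_within_perturbation Wflow tI)).
(* [derive_within] is known only at points of the interval, so it is replaced there by the closed
   form before limits are taken. *)
apply: (@subspace_eq_continuous _ _ _ (fun t =>
    2^-1 * fisher (G s t) (velocity s t) (velocity s t)
    + 2^-1 * \sum_i Var (rowc (G s t) i) (rowc (Fc (G s t)) i))).
  by move=> t; rewrite inE => tI; rewrite /from_subspace /lag derive_G.
apply/subspace_continuousP => t tI.
have GM : assignment_manifold (G s t) by exact: G_manifold.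
apply: cvg_lagrangian.
- by move=> p q; rewrite gt_eqF//; case: GM.
- by move/subspace_continuousP: Gc; exact.
- by move/subspace_continuousP: Vc; exact.
- apply: (@cvg_comp _ _ _ (G s) Fc _ (nbhs (G s t))).
    by move/subspace_continuousP: Gc; exact.
  exact: rowwise_continuous.
Qed.

Let lag_growth s t : - eps < s < eps -> t \in `[t0, t1] ->
  lag 0 t + s * (phi t * replicator (W t) (Fc (W t)) r j) <= lag s t.
Proof.
move=> se tI.
have e0 : - eps < 0 < eps.
  by rewrite oppr_lt0 andbb invr_gt0 exprn_gt0// subr_gt0.
have V0 u : tangent (velocity u t).
  have /tangentP Y0 := replicator_tangent (Fc (W t)) (W_manifold tI).
  have /tangentP E0 := mass_shift_tangent (R := R) r i k.
  apply/tangentP => q; under eq_bigr do rewrite mxE [X in _ + X]mxE.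
  by rewrite big_split /= -mulr_sumr Y0 E0 mulr0 addr0.
have G0 : G 0 t = W t by rewrite /G /flow_perturbation mul0r scale0r addr0.
rewrite /lag !derive_G// !lagrangian_square//; try exact: G_manifold.
have -> : velocity 0 t - replicator (G 0 t) (Fc (G 0 t)) = 0.
  by rewrite G0 /velocity mul0r scale0r addr0 subrr.
rewrite fisher0 mulr0 add0r.
apply: ler_wpDl; first by rewrite mulr_ge0 ?invr_ge0 ?ler0n ?fisher_ge0//; exact: G_manifold.
rewrite !mxdot_elementary G0.
have VE u q : velocity u t q j = replicator (W t) (Fc (W t)) q j.
  by rewrite mxE [X in _ + X]mxE mass_shift_eq0 ?mulr0 ?addr0// eq_sym.
under eq_bigr do rewrite VE.
under [leRHS]eq_bigr do rewrite VE.
rewrite [leRHS](eq_bigr (fun q => replicator (W t) (Fc (W t)) q j * W t q i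
    + (q == r)%:R * (s * (phi t * replicator (W t) (Fc (W t)) q j)))); last first.
  move=> q _; have -> : G s t q i = W t q i + (s * phi t) * (q == r)%:R.
    by rewrite mxE [X in _ + X]mxE mass_shift_src.
  by ring.
rewrite big_split /= lerD2l [leRHS](bigD1 r)//= eqxx mul1r big1 ?addr0//.
by move=> q qr; rewrite (negbTE qr) mul0r.
Qed.

Lemma flow_not_critical : ~ critical_point t0 t1 (action t0 t1 Fc) W.
Proof.
move=> crit.
have e0 : 0 < eps by rewrite invr_gt0 exprn_gt0// subr_gt0.
have := crit _ _ e0 smooth_variation_bump.
(* The integral of [g] serves as the slope [kappa] in [is_derive_zero_no_growth]. *)
pose g t := phi t * replicator (W t) (Fc (W t)) r j.
have gc : {within `[t0, t1], continuous g}.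
  rewrite (_ : g = flow_eval W (FMul bump_poly (flow_deriv i j (FEntry r j)))).
    exact: flow_eval_continuous Wflow _.
  by apply/funext => t; rewrite /g -flow_deriv_entryE.
have growth t : t \in `[t0, t1] -> 0 < replicator (W t) (Fc (W t)) r j.
  by move=> tI; apply: elementary_growth_gt0 => //; exact: W_manifold.
have g0 : 0 < \int[lebesgue_measure]_(t in `[t0, t1]) g t.
  apply: Rintegral_gt0 => // t tI.
    rewrite mulr_ge0 ?(ltW (growth _ _))// phiE.
    move: (tI); rewrite in_itv /= => /andP[at_ tb].
    have [W0 _] := W_manifold tI.
    by rewrite !mulr_ge0 ?subr_ge0 ?(ltW (W0 _ _)).
  have tI' : t \in `[t0, t1] by exact: subset_itv_oo_cc.
  rewrite mulr_gt0 ?growth// phiE.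
  move: (tI); rewrite in_itv /= => /andP[at_ tb].
  have [W0 _] := W_manifold tI'.
  by rewrite !mulr_gt0 ?subr_gt0 ?W0.
apply: (is_derive_zero_no_growth e0 g0) => s /andP[s0 se].
have es : - eps < s < eps by rewrite se andbT (lt_trans _ s0)// oppr_lt0.
have ee : - eps < 0 < eps by rewrite oppr_lt0 e0.
have sgc : {within `[t0, t1], continuous (fun t => s * g t)}.
  apply/subspace_continuousP => t tI; apply: cvgM; first exact: cvg_cst.
  by move/subspace_continuousP: gc; exact.
have int f (fc : {within `[t0, t1], continuous f}) := itv_continuous_integrable fc.
(* Moving the action at 0 to the other side and merging the integrals leaves [lag_growth] integrated
   over the interval. *)
rewrite lerBrDl /action -/(lag s) -/(lag 0) -RintegralZl//; last exact: int.
rewrite -RintegralD//; [|by apply: int; exact: lag_continuous|exact: int].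
apply: le_Rintegral => //.
- by apply: int; apply: within_continuousD => //; exact: lag_continuous.
- by apply: int; exact: lag_continuous.
- by move=> t tI; exact: lag_growth.
Qed.

End FirstVariation.

Unset Implicit Arguments.
Set Strict Implicit.

Theorem mainTheorem5 (R : realType) (n : nat) (n_gt2 : (2 < n)%N) :
  let i1 : 'I_n := Ordinal (ltn_trans (isT : (0 < 2)%N) n_gt2) in
  let i2 : 'I_n := Ordinal (ltn_trans (isT : (1 < 2)%N) n_gt2) in
  let F : 'M[R]_n := std_basis i2 *m (std_basis i1)^T in
  (forall p : 'cV[R]_n, simplex p ->
    [/\ F *m p = p i1 0 *: std_basis i2,
        (replicator_mx p *m (F - F^T) *m replicator_mx p *m F *m p) i1 0
          = - (p i1 0 ^+ 2 * p i2 0 * (1 - p i1 0 - p i2 0)) &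
        - (p i1 0 ^+ 2 * p i2 0 * (1 - p i1 0 - p i2 0)) != 0]) /\
  (forall m : nat, (0 < m)%N ->
    let Fc : 'M[R]_(m, n) -> 'M[R]_(m, n) := rowwise F in
    (forall W : 'M[R]_(m, n), assignment_manifold W ->
      let Y := replicator W (Fc W) in
      replicator W ('d Fc W Y - adjoint ('d Fc W) Y) <> 0) /\
    (forall (t0 t1 : R) (W : R -> 'M[R]_(m, n)), t0 < t1 ->
      assignment_flow_solution t0 t1 Fc W ->
      ~ critical_point t0 t1 (action t0 t1 Fc) W)).
Proof.
move=> i1 i2 F; pose i3 : 'I_n := Ordinal n_gt2.
have i12 : i1 != i2 by [].
have i13 : i1 != i3 by [].
have i23 : i2 != i3 by [].
split=> [p pS|m m_gt0 Fc].
  split; [exact: elementary_mul_col|exact: skew_elementary_replicator|].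
  (* The third coordinate, available since n > 2, is positive and bounds 1 - p^1 - p^2 from
     below. *)
  have [p0 _] := pS; have p123 := simplex_sum3_le1 pS i12 i13 i23.
  rewrite oppr_eq0 gt_eqF// !mulr_gt0 ?exprn_gt0//.
  have := p0 i3; lra.
(* A single row suffices for both remaining claims; the first one is taken. *)
pose r : 'I_m := Ordinal m_gt0.
split=> [W WM|t0 t1 W t01 Wflow].
  exact: (skew_replicator_neq0 i12 r i13 i23 WM).
exact: (flow_not_critical r i12 i13 i23 t01 Wflow).
Qed.
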